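(* Let $m\ge1$ be an integer and let $\{B(t):0\le t\le1\}$ be a Brownian bridge. Then the following identity in law of processes holds: $$\{B(H_m(t)):0\le t\le 1\}\stackrel{d}{=}\Big\{B(H_m(t))-4(2m+1)\frac{(2m-1)!}{m((m-1)!)^2}(t(1-t))^m\int_0^1B(H_m(s))\,ds:0\le t\le1\Big\}.$$
   Context: $H_m(x)=\frac{(2m-1)!}{((m-1)!)^2}\int_0^x t^{m-1}(1-t)^{m-1}dt$, $0\le x\le1$, is the distribution function of the Beta$(m,m)$ law. A Brownian bridge is a centered Gaussian process $B$ on $[0,1]$ with continuous paths and $\mathbb E(B(u)B(v))=u\wedge v-uv$. *)

(* Defs.v *)
From HB Require Import structures.
From mathcomp Require Import all_boot all_order all_algebra.
From mathcomp Require Import all_classical all_reals all_analysis.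
Import Order.TTheory GRing.Theory Num.Theory.
Import numFieldNormedType.Exports.
Set Implicit Arguments.
Unset Strict Implicit.
Unset Printing Implicit Defensive.
Local Open Scope classical_set_scope.
Local Open Scope ring_scope.

(* A process indexed by [D : set R] is a map [X : R -> T -> R], time first;
   only its values at times in [D] are ever constrained or used. *)
Definition is_process (R : realType) (d : measure_display)
    (T : measurableType d) (D : set R) (X : R -> T -> R) : Prop :=
  forall t, D t -> measurable_fun [set: T] (X t).

(* The product sigma-algebra of R^D, carried by [R -> R]: it is generated by
   the evaluations at the times in [D] only, so that membership of a path
   depends only on its restriction to [D].  For D = [0, 1], its trace on the
   continuous paths is the Borel sigma-algebra of C([0, 1]). *)
Definition path_measurable (R : realType) (D : set R) : set (set (R -> R)) :=
  <<s \bigcup_(t in D)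
        preimage_set_system [set: R -> R] (fun w : R -> R => w t) measurable >>.

Definition path_law (R : realType) (d : measure_display)
    (T : measurableType d) (P : probability T R) (X : R -> T -> R) :
    set (R -> R) -> \bar R :=
  fun A => P ((fun w : T => X ^~ w) @^-1` A).

(* The coordinates are required to be random variables because a measure has
   no meaningful value on nonmeasurable sets. *)
Definition eq_in_law (R : realType) (D : set R)
    (d1 : measure_display) (T1 : measurableType d1) (P1 : probability T1 R)
    (X : R -> T1 -> R)
    (d2 : measure_display) (T2 : measurableType d2) (P2 : probability T2 R)
    (Y : R -> T2 -> R) : Prop :=
  [/\ is_process D X, is_process D Y &
      forall A, path_measurable D A -> path_law P1 X A = path_law P2 Y A].

(* Gaussian law with mean [mu] and standard deviation [sigma]; [normal_prob]
   with zero deviation is the uniform law on [0, 1], hence the case split. *)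
Definition gaussian_law (R : realType) (mu sigma : R) (A : set R) : \bar R :=
  if sigma == 0 then \d_mu A else normal_prob mu sigma A.

Definition gaussian_rv (R : realType) (d : measure_display)
    (T : measurableType d) (P : probability T R) (X : T -> R) : Prop :=
  measurable_fun [set: T] X /\
  exists mu sigma : R, 0 <= sigma /\
    forall A : set R, measurable A -> P (X @^-1` A) = gaussian_law mu sigma A.

Definition gaussian_process (R : realType) (d : measure_display)
    (T : measurableType d) (P : probability T R) (D : set R)
    (X : R -> T -> R) : Prop :=
  forall (n : nat) (t a : 'I_n -> R), (forall i, D (t i)) ->
    gaussian_rv P (fun w => \sum_(i < n) a i * X (t i) w).

Definition brownian_bridge (R : realType) (d : measure_display)
    (T : measurableType d) (P : probability T R) (B : R -> T -> R) : Prop :=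
  [/\ gaussian_process P `[0, 1] B,
      forall t, t \in `[0, 1] -> ('E_P[B t] = 0)%E,
      forall w, {within `[0, 1], continuous (B ^~ w)} &
      forall u v, u \in `[0, 1] -> v \in `[0, 1] ->
        'E_P[(B u \* B v)%R]%E = (Num.min u v - u * v)%:E].

Definition beta_cdf (R : realType) (m : nat) (x : R) : R :=
  ((2 * m - 1)`!)%:R / ((m - 1)`!)%:R ^+ 2 *
  \int[lebesgue_measure]_(t in `[0, x]) (t ^+ (m - 1) * (1 - t) ^+ (m - 1)).

(* Main.v *)
Require Import Defs.
From HB Require Import structures.
From mathcomp Require Import all_boot all_order all_algebra.
From mathcomp Require Import all_classical all_reals all_analysis.
From mathcomp Require Import measurable_realfun zify ring lra.
Import Order.TTheory GRing.Theory Num.Theory.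
Import numFieldNormedType.Exports.
Local Open Scope classical_set_scope.
Local Open Scope ring_scope.

(* Write X_t = B(H_m(t)), I = int_0^1 X and r(t) = E(X_t I).  Integrating the
   covariance kernel of X gives r(t) = C (t(1-t))^m / (2m), with C the
   normalizing constant of H_m, and Var I = 1/(4(2m+1)), so that the
   deterministic factor g in the statement satisfies r = (Var I / 2) g.  Hence
   X - g I has the covariance of X: for a linear combination L and
   b = L(g), Var(L(X) - b I) = Var L(X) - 2 b L(r) + b^2 Var I = Var L(X).

   As I is the pointwise limit of Riemann sums of X, L(X) - b I is a limit of
   centered Gaussian variables, and E cos(L(X) - b I + th) is read off their
   variances, because the mean of cos(Z + th) over a centered Gaussian Z is a
   continuous function of the standard deviation of Z.

   Equality of these trigonometric expectations implies equality in law by a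
   monotone class argument: the smallest class of path functionals containing
   the trigonometric ones and stable under linear combinations and bounded
   pointwise limits is stable under products, hence contains the indicators of
   all measurable sets of paths. *)

(** * Determination of a law by its trigonometric expectations *)

Section trig_closure.
Set Implicit Arguments.
Unset Strict Implicit.
Variables (R : realType) (D : set R).

Definition lin_eval (s : seq (R * R)) (w : R -> R) : R :=
  \sum_(p <- s) p.1 * w p.2.

Definition times_in (s : seq (R * R)) := forall p, p \in s -> D p.2.

(** The phase [th] supplies the sines and lets a product of two generators be a combination of
    generators. Each limit carries a uniform bound [M], so that bounded convergence carries
    equalities of expectations through the induction. *)
Inductive trig_closure : ((R -> R) -> R) -> Prop :=
| tc_cos s th : times_in s -> trig_closure (fun w => cos (lin_eval s w + th))
| tc_lin a b f g : trig_closure f -> trig_closure g ->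
    trig_closure (fun w => a * f w + b * g w)
| tc_lim (f_ : nat -> (R -> R) -> R) f M : (forall n, trig_closure (f_ n)) ->
    (forall n w, `|f_ n w| <= M) ->
    (forall w, f_ ^~ w @ \oo --> f w) -> trig_closure f.

Lemma tc_eq f g : f =1 g -> trig_closure f -> trig_closure g.
Proof. by move=> /funext ->. Qed.

Lemma tc_cst c : trig_closure (cst c).
Proof.
apply: (@tc_eq (fun w => c * cos (lin_eval [::] w + 0) + 0 * cos (lin_eval [::] w + 0))).
  by move=> w; rewrite /lin_eval big_nil addr0 cos0 mul0r addr0 mulr1.
by apply: tc_lin; apply: tc_cos.
Qed.

Lemma tc_addc a c f : trig_closure f -> trig_closure (fun w => a * f w + c).
Proof.
move=> tf; apply: (@tc_eq (fun w => a * f w + c * cst 1 w)).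
  by move=> w; rewrite /= mulr1.
by apply: tc_lin => //; exact: tc_cst.
Qed.

Lemma tc_bounded f : trig_closure f -> exists M, forall w, `|f w| <= M.
Proof.
elim=> {f} [s th _|a b f g _ [M fM] _ [N gN]|f_ f M _ _ fM f_f].
- by exists 1 => w; exact: cos_max.
- exists (`|a| * M + `|b| * N) => w; apply: le_trans (ler_normD _ _) _.
  by rewrite !normrM lerD// ler_wpM2l.
- exists M => w; apply: (cvgr_to_le (cvg_norm (f_f w))).
  by near=> n; exact: fM.
Unshelve. all: by end_near. Qed.

Lemma lin_eval_cat s t w : lin_eval (s ++ t) w = lin_eval s w + lin_eval t w.
Proof. by rewrite /lin_eval big_cat. Qed.

Lemma lin_eval_scale a s w :
  lin_eval [seq (a * p.1, p.2) | p <- s] w = a * lin_eval s w.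
Proof.
by rewrite /lin_eval big_map mulr_sumr; apply: eq_bigr => p _ /=; rewrite mulrA.
Qed.

Lemma times_in_cat s t : times_in s -> times_in t -> times_in (s ++ t).
Proof. by move=> hs ht p; rewrite mem_cat => /orP[/hs|/ht]. Qed.

Lemma times_in_scale a s : times_in s ->
  times_in [seq (a * p.1, p.2) | p <- s].
Proof. by move=> hs p /mapP[q /hs qD ->]. Qed.

(** Induction on the first factor and, when it is a cosine, on the second. Two cosines multiply by
    the product-to-sum formula; a limit times a fixed member stays uniformly bounded because members
    are bounded. *)
Lemma tc_mul f g : trig_closure f -> trig_closure g ->
  trig_closure (fun w => f w * g w).
Proof.
move=> tf; move: g.
elim: tf => {f}
  [s th hs|a b f f' _ ihf _ ihf'|f_ f M tf ih fM f_f] g tg.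
- elim: tg => {g} [t th' ht|a b f f' _ ihf _ ihf'|f_ f M tf ih fM f_f].
  + apply: (@tc_eq (fun w => 2^-1 * cos (lin_eval (s ++ t) w + (th + th'))
      + 2^-1 * cos (lin_eval (s ++ [seq (-1 * p.1, p.2) | p <- t]) w + (th - th')))).
      move=> w; rewrite !lin_eval_cat lin_eval_scale mulN1r.
      rewrite [X in cos X](_ : _ =
        (lin_eval s w + th) + (lin_eval t w + th')); last by ring.
      rewrite [X in _ + _ * cos X](_ : _ =
        (lin_eval s w + th) - (lin_eval t w + th')); last by ring.
      by rewrite cosD cosB; field.
    by apply: tc_lin; apply: tc_cos; apply: times_in_cat => //; exact: times_in_scale.
  + apply: (@tc_eq (fun w => a * (cos (lin_eval s w + th) * f w)
                           + b * (cos (lin_eval s w + th) * f' w))).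
      by move=> w; ring.
    exact: tc_lin.
  + apply: (@tc_lim (fun n w => cos (lin_eval s w + th) * f_ n w) _ M) => //.
      move=> n w; rewrite normrM -[M]mul1r ler_pM//; exact: cos_max.
    by move=> w; apply: cvgMl_tmp; exact: f_f.
- apply: (@tc_eq (fun w => a * (f w * g w) + b * (f' w * g w))).
    by move=> w; ring.
  by apply: tc_lin; [exact: ihf|exact: ihf'].
- have [N gN] := tc_bounded tg.
  apply: (@tc_lim (fun n w => f_ n w * g w) _ (M * N)).
  + by move=> n; exact: ih.
  + by move=> n w; rewrite normrM ler_pM.
  + by move=> w; apply: cvgMr_tmp; exact: f_f.
Qed.



Let smoothstep (s : R) : R := (3 * s - s ^+ 3) / 2.

Let smoothstep_iter_odd n s :
  iter n smoothstep (- s) = - iter n smoothstep s.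
Proof. by elim: n => //= n ->; rewrite /smoothstep; field. Qed.

(** One step multiplies the gap [1 - t] by [1 - (t + t ^+ 2) / 2], and [s <= t] makes this factor at
    most [1 - s / 2]. *)
Let smoothstep_iter_bound n s : 0 <= s <= 1 ->
  s <= iter n smoothstep s <= 1 /\ 1 - iter n smoothstep s <= (1 - s / 2) ^+ n.
Proof.
move=> /andP[s0 s1]; elim: n => [|n [/andP[]]] /=.
  by rewrite lexx s1 expr0 gerBl.
set t := iter n smoothstep s => st t1 h; rewrite /smoothstep.
have E : 1 - (3 * t - t ^+ 3) / 2 = (1 - t) * (1 - (t + t ^+ 2) / 2) by field.
have t0 : 0 <= t by exact: le_trans st.
have t21 : t ^+ 2 <= 1 by rewrite expr_le1.
have t2 : 0 <= t ^+ 2 by rewrite sqr_ge0.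
have u0 : 0 <= 1 - (t + t ^+ 2) / 2 by lra.
split; last by rewrite E [leRHS]exprSr; apply: ler_pM => //; lra.
apply/andP; split; last first.
  by rewrite -subr_ge0 E mulr_ge0// subr_ge0.
have : 0 <= t * (1 - t ^+ 2) by rewrite mulr_ge0// subr_ge0.
by rewrite mulrBr mulr1 -exprS; lra.
Qed.

(* The odd map s |-> (3 s - s^3) / 2 has fixed points -1, 0, 1 in [-1, 1],
   and 0 is repelling, so its iterates converge to the sign. *)
Let smoothstep_iter_cvg s : -1 <= s <= 1 ->
  iter n smoothstep s @[n --> \oo] --> Num.sg s.
Proof.
have pos t : 0 < t <= 1 -> iter n smoothstep t @[n --> \oo] --> (1 : R).
  move=> /andP[t0 t1].
  apply: (@squeeze_cvgr _ _ _ _ (fun n => 1 - (1 - t / 2) ^+ n) (cst 1)).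
  - near=> n; have [|/andP[_ -> h]] := @smoothstep_iter_bound n t.
      by rewrite t1 ltW.
    by rewrite andbT lerBlDr -lerBlDl.
  - rewrite -[X in _ --> X]subr0; apply: cvgB; first exact: cvg_cst.
    by apply: cvg_expr; rewrite ger0_norm; lra.
  - exact: cvg_cst.
move=> /andP[sN1 s1]; have [s0|s0|->] := ltgtP s 0.
- rewrite (ltr0_sg s0).
  have -> : (fun n => iter n smoothstep s) =
      (fun n => - iter n smoothstep (- s)).
    by apply/funext => n; rewrite smoothstep_iter_odd opprK.
  by apply: cvgN; apply: pos; rewrite oppr_gt0 s0 lerNl.
- by rewrite (gtr0_sg s0); apply: pos; rewrite s0.
- rewrite sgr0; apply: cvg_near_cst; apply: nearW.
  by elim=> //= n ->; rewrite /smoothstep; field.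
Unshelve. all: by end_near. Qed.

Let smoothstep_iter_norm n s : -1 <= s <= 1 -> `|iter n smoothstep s| <= 1.
Proof.
move=> /andP[sN1 s1]; rewrite ler_norml.
have [s0|s0] := lerP 0 s.
  have [|/andP[a b] _] := @smoothstep_iter_bound n s; first by rewrite s0.
  by rewrite b andbT; lra.
have [|/andP[]] := @smoothstep_iter_bound n (- s); first by apply/andP; lra.
by rewrite smoothstep_iter_odd => a b _; lra.
Qed.

(** The iterates of [smoothstep] at [f] are polynomials in [f], hence in the class by [tc_mul], and
    they converge boundedly to the sign. *)
Lemma tc_sg f : trig_closure f -> (forall w, -1 <= f w <= 1) ->
  trig_closure (fun w => Num.sg (f w)).
Proof.
move=> tf f1; apply: (@tc_lim (fun n w => iter n smoothstep (f w)) _ 1).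
- elim=> [//|n ih] /=; rewrite /smoothstep.
  pose g w := iter n smoothstep (f w).
  apply: (@tc_eq (fun w => 3 / 2 * g w + (- 2^-1) * (g w * g w * g w))).
    by move=> w; rewrite /g; field.
  by apply: tc_lin => //; apply: tc_mul => //; exact: tc_mul.
- by move=> n w; exact: smoothstep_iter_norm.
- by move=> w; exact: smoothstep_iter_cvg.
Qed.

(** A coordinate is unbounded, so [tc_sg] does not apply to it directly; [sin (x / n.+1%:R)] lies in
    [-1, 1] and has the sign of [x] for large [n]. *)
Let sg_sin_cvg (x : R) : Num.sg (sin (x / n.+1%:R)) @[n --> \oo] --> Num.sg x.
Proof.
have pos y : 0 < y -> \forall n \near \oo, 0 < sin (y / n.+1%:R) :> R.
  move=> y0; have y0' : 0 < 2 / y :> R by rewrite divr_gt0.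
  near=> n; apply: sin_gt0_pi; apply/andP; split; first by rewrite divr_gt0.
  (* It suffices that the argument drop below 2, which is at most pi. *)
  apply: lt_le_trans (pi_ge2 R); rewrite mulrC -ltr_pdivlMr//.
  near: n; exact: (near_infty_natSinv_lt (PosNum y0')).
apply: cvg_near_cst; have [x0|x0|->] := ltgtP x 0.
- have := pos (- x); rewrite oppr_gt0 x0 => /(_ erefl); apply: filterS => n.
  by rewrite mulNr sinN oppr_gt0 (ltr0_sg x0) => /ltr0_sg.
- by have := pos x x0; apply: filterS => n; rewrite (gtr0_sg x0) => /gtr0_sg.
- by apply: nearW => n; rewrite mul0r sin0.
Unshelve. all: by end_near. Qed.

Lemma tc_sg_coord t y : D t -> trig_closure (fun w => Num.sg (w t - y)).
Proof.
move=> Dt; apply: (@tc_lim (fun n w => Num.sg (sin ((w t - y) / n.+1%:R))) _ 1).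
- move=> n; apply: tc_sg; last first.
    by move=> w; rewrite sin_geN1 sin_le1.
  (* A sine is a cosine with its phase lowered by [pi / 2]. *)
  apply: (@tc_eq (fun w => cos (lin_eval [:: (n.+1%:R^-1, t)] w
      + (- (y / n.+1%:R) - pi / 2)))).
    move=> w; rewrite /lin_eval big_seq1 /= addrA -[RHS]cosBpihalf.
    by congr cos; rewrite mulrBl mulrC.
  by apply: tc_cos => p; rewrite inE => /eqP ->.
- by move=> n w; case: sgrP; rewrite ?normr0 ?normrN1 ?normr1.
- by move=> w; exact: sg_sin_cvg.
Qed.

(** The function (1 + sg) / 2 takes the value 1/2 at its threshold. Letting the threshold decrease
    strictly to [y] gives 0 at [w t = y], hence the open ray. *)
Let tc_ray t y : D t ->
  trig_closure (\1_((fun w : R -> R => w t) @^-1` `]y, +oo[)).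
Proof.
move=> Dt.
apply: (@tc_lim (fun n w =>
  2^-1 * Num.sg (w t - (y + n.+1%:R^-1)) + 2^-1) _ 1).
- by move=> n; apply: tc_addc; exact: tc_sg_coord.
- by move=> n w; case: sgrP => _; rewrite ler_norml; apply/andP; split; lra.
move=> w; apply: cvg_near_cst; rewrite indicE.
have [wy|wy] := ltP y (w t).
- rewrite mem_set/= ?in_itv/= ?wy//.
  have h : 0 < w t - y by rewrite subr_gt0.
  have := near_infty_natSinv_lt (PosNum h); apply: filterS => n /= hn.
  rewrite gtr0_sg/=; first by rewrite mulr1; field.
  by rewrite subr_gt0 -ltrBrDl.
- rewrite memNset/= ?in_itv/= ?andbT -?leNgt//; last first.
    by apply/negP; rewrite -leNgt.
  near=> n; rewrite ltr0_sg/=; first by rewrite mulrN1 addNr.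
  by rewrite subr_lt0 (le_lt_trans wy)// ltrDl invr_gt0.
Unshelve. all: by end_near. Qed.

(** Stability under products gives finite unions, the indicator of a union being the sum minus the
    product; countable unions are then bounded limits. *)
Lemma sigma_algebra_tc :
  sigma_algebra [set: R -> R] [set A | trig_closure \1_A].
Proof.
split=> /=.
- by apply: tc_eq (tc_cst 0) => w; rewrite indic0.
- move=> A tA; apply: tc_eq (tc_addc (-1) 1 tA) => w.
  rewrite setTD !indicE in_setC; case: (_ \in _) => /=; ring.
move=> A tA; pose B n := \bigcup_(k < n) A k.
have tB n : trig_closure \1_(B n).
  elim: n => [|n ih].
    by apply: tc_eq (tc_cst 0) => w; rewrite /B bigcup_mkord big_ord0 indic0.
  apply: (@tc_eq (fun w => 1 * (1 * \1_(B n) w + 1 * \1_(A n) w)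
     + (-1) * (\1_(B n) w * \1_(A n) w))).
    move=> w; have -> : B n.+1 = B n `|` A n.
      by rewrite /B !bigcup_mkord big_ord_recr.
    by rewrite !indicE in_setU; do 2 case: (_ \in _) => /=; ring.
  by apply: tc_lin; [exact: tc_lin|exact: tc_mul].
apply: (@tc_lim (fun n => \1_(B n)) _ 1) => //.
  by move=> n w; rewrite indicE; case: (_ \in _); rewrite ?normr1 ?normr0.
move=> w; apply: cvg_near_cst; have [[k _ Akw]|nA] := pselect ((\bigcup_k A k) w).
- near=> n; rewrite !indicE !mem_set//; first by exists k.
  by exists k => //=; near: n; exact: nbhs_infty_gt.
- near=> n; rewrite !indicE !memNset//.
  by move=> [k _ Akw]; apply: nA; exists k.
Unshelve. all: by end_near. Qed.

Lemma tc_indic A : path_measurable D A -> trig_closure \1_A.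
Proof.
apply: (smallest_sub sigma_algebra_tc) => {A} _ [t Dt [B mB <-]] /=.
rewrite setTI; move: B mB.
have -> : measurable = <<s @RGenOInfty.G R >>.
  exact: (RGenOInfty.measurableE R).
apply: smallest_sub; last by move=> _ [y ->]; exact: tc_ray.
(* The sets of reals whose preimage under evaluation at [t] has its indicator in the class form a
   sigma-algebra. *)
have [h0 hC hU] := sigma_algebra_tc; split=> /=.
- by rewrite preimage_set0.
- by move=> A /hC; rewrite !setTD.
- by move=> A /hU; rewrite preimage_bigcup.
Qed.

End trig_closure.

(** * Bounded functions under a probability measure *)

Section bounded_integral.
Set Implicit Arguments.
Unset Strict Implicit.
Variables (R : realType) (d : measure_display) (T : measurableType d).
Variable P : probability T R.

Lemma bounded_integrable (f : T -> R) (M : R) : measurable_fun setT f ->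
  (forall x, `|f x| <= M) -> P.-integrable setT (EFin \o f).
Proof.
move=> mf fM; apply: measurable_bounded_integrable => //.
  exact: fin_num_fun_lty.
exists M; split; first exact: num_real.
by move=> K MK x _; apply: le_trans (fM x) _; exact: ltW.
Qed.

Lemma bounded_cvg_integral (f_ : nat -> T -> R) (f : T -> R) (M : R) :
  (forall n, measurable_fun setT (f_ n)) ->
  (forall n x, `|f_ n x| <= M) -> (forall x, f_ ^~ x @ \oo --> f x) ->
  measurable_fun setT f /\
  (\int[P]_x (f_ n x)%:E @[n --> \oo] --> \int[P]_x (f x)%:E)%E.
Proof.
move=> mf fM f_f.
have mf' : measurable_fun setT f.
  by apply: (measurable_fun_cvg mf) => x _; exact: f_f.
split=> //.
have [|||||_ _] := @dominated_convergence _ _ _ P setT measurableT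
  (fun n x => (f_ n x)%:E) (EFin \o f) (EFin \o cst M).
- by move=> n; exact/measurable_EFinP.
- exact/measurable_EFinP.
- by apply: aeW => x _; apply/fine_cvgP; split; [exact: nearW|exact: f_f].
- by apply: (@bounded_integrable _ `|M|).
- by apply: aeW => x n _; rewrite lee_fin.
exact.
Qed.

End bounded_integral.

(** * From trigonometric expectations to equality in law *)

Section law.
Set Implicit Arguments.
Unset Strict Implicit.
Variables (R : realType) (D : set R).
Variables (d1 : measure_display) (T1 : measurableType d1).
Variables (d2 : measure_display) (T2 : measurableType d2).
Variables (P1 : probability T1 R) (P2 : probability T2 R).
Variables (X : R -> T1 -> R) (Y : R -> T2 -> R).
Hypotheses (pX : is_process D X) (pY : is_process D Y).
Hypothesis eq_cos : forall s th, times_in D s ->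
  (\int[P1]_x (cos (lin_eval s (X ^~ x) + th))%:E =
   \int[P2]_x (cos (lin_eval s (Y ^~ x) + th))%:E)%E.

Lemma measurable_lin_eval d (T : measurableType d) (Z : R -> T -> R) s :
  is_process D Z -> times_in D s ->
  measurable_fun setT (fun x => lin_eval s (Z ^~ x)).
Proof.
move=> pZ; elim: s => [_|p s ih hs].
  by under eq_fun do rewrite /lin_eval big_nil; exact: measurable_cst.
under eq_fun do rewrite /lin_eval big_cons -/(lin_eval s _).
apply: measurable_funD.
  by apply: measurable_funM => //; apply: pZ; apply: hs; rewrite mem_head.
by apply: ih => q qs; apply: hs; rewrite inE qs orbT.
Qed.

Lemma measurable_cos_lin d (T : measurableType d) (Z : R -> T -> R) s th :
  is_process D Z -> times_in D s ->
  measurable_fun setT (fun x => cos (lin_eval s (Z ^~ x) + th)).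
Proof.
move=> pZ hs; apply: measurableT_comp.
  by apply: continuous_measurable_fun; exact: continuous_cos.
by apply: measurable_funD => //; exact: measurable_lin_eval.
Qed.

(** Measurability is proved together with the equality because linearity and bounded convergence
    rely on it at each stage of the induction. *)
Let tc_law f : trig_closure D f ->
  [/\ measurable_fun setT (fun x => f (X ^~ x)),
      measurable_fun setT (fun x => f (Y ^~ x)) &
      (\int[P1]_x (f (X ^~ x))%:E = \int[P2]_x (f (Y ^~ x))%:E)%E].
Proof.
elim=> {f} [s th hs|a b f g tf [mf1 mf2 ef] tg [mg1 mg2 eg]|f_ f M tf ih fM f_f].
- by split; [exact: measurable_cos_lin|exact: measurable_cos_lin|exact: eq_cos].
- have [M fM] := tc_bounded tf; have [N gN] := tc_bounded tg.
  split; [by apply: measurable_funD; exact: measurable_funM..|].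
  have E d (T : measurableType d) (P : probability T R) (Z : T -> R -> R) :
      measurable_fun setT (fun x => f (Z x)) ->
      measurable_fun setT (fun x => g (Z x)) ->
      (\int[P]_x (a * f (Z x) + b * g (Z x))%:E =
       a%:E * \int[P]_x (f (Z x))%:E + b%:E * \int[P]_x (g (Z x))%:E)%E.
    move=> mf mg.
    have If : P.-integrable setT (fun x => (f (Z x))%:E).
      by apply: (@bounded_integrable _ _ _ P _ M).
    have Ig : P.-integrable setT (fun x => (g (Z x))%:E).
      by apply: (@bounded_integrable _ _ _ P _ N).
    under eq_integral do rewrite EFinD !EFinM.
    by rewrite integralD//= ?integralZl//; exact: integrableZl.
  rewrite (E _ _ P1 (fun x => X ^~ x))// (E _ _ P2 (fun x => Y ^~ x))//.
  by rewrite ef eg.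
- have [mX cX] := @bounded_cvg_integral _ _ _ P1 (fun n x => f_ n (X ^~ x))
    (fun x => f (X ^~ x)) M (fun n => let: And3 h _ _ := ih n in h)
    (fun n x => fM n _) (fun x => f_f _).
  have [mY cY] := @bounded_cvg_integral _ _ _ P2 (fun n x => f_ n (Y ^~ x))
    (fun x => f (Y ^~ x)) M (fun n => let: And3 _ h _ := ih n in h)
    (fun n x => fM n _) (fun x => f_f _).
  split=> //; rewrite -(cvg_lim _ cX)// -(cvg_lim _ cY)//.
  by congr (limn _); apply/funext => n; case: (ih n).
Qed.

Lemma eq_in_law_cos : eq_in_law D P1 X P2 Y.
Proof.
split=> // A /tc_indic /tc_law[mX mY].
have E d (T : measurableType d) (P : probability T R) (Z : R -> T -> R) :
    measurable_fun setT (fun x => \1_A (Z ^~ x) : R) ->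
    (\int[P]_x (\1_A (Z ^~ x))%:E = path_law P Z A)%E.
  move=> mZ; rewrite /path_law; set B := _ @^-1` A.
  have EB x : \1_A (Z ^~ x) = \1_B x :> R by rewrite !indicE.
  (* Only the indicator is known to be measurable so far; [B] is the preimage of 1 under it. *)
  have mB : measurable B.
    have := mZ measurableT [set 1] (measurable_set1 _); rewrite setTI.
    congr measurable; apply/seteqP; split=> x /=; rewrite indicE.
      by case: (boolP (_ \in A)) => [/set_mem//|_ /eqP]; rewrite eq_sym oner_eq0.
    by move=> Bx; rewrite mem_set.
  by under eq_integral do rewrite EB; rewrite integral_indic// setIT.
by rewrite E// E.
Qed.

End law.

(** * Centered Gaussian variables *)

Section normal_integral.
Set Implicit Arguments.
Unset Strict Implicit.
Variable R : realType.
Local Notation mu := (@lebesgue_measure R).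
Implicit Types (m s a b x : R) (f G : R -> R).
Local Open Scope ereal_scope.

Let bounded_integral_normal_prob m s f M : measurable_fun setT f ->
  (forall x, `|f x| <= M)%R ->
  \int[normal_prob m s]_x (f x)%:E =
  \int[mu]_x (f x * normal_pdf m s x)%:E.
Proof.
move=> mf fM; under [RHS]eq_integral do rewrite EFinM.
have If : (normal_prob m s).-integrable setT (EFin \o f).
  exact: (@bounded_integrable _ _ _ (normal_prob m s) f M).
rewrite -(Radon_Nikodym_change_of_variables (normal_prob_dominates m s))//=.
apply: ae_eq_integral => //.
- apply: emeasurable_funM; first exact/measurable_EFinP.
  apply: (measurable_int mu).
  by apply: Radon_Nikodym_integrable; exact: normal_prob_dominates.
- apply: emeasurable_funM; first exact/measurable_EFinP.
  by apply/measurable_EFinP; exact: measurable_normal_pdf.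
(* The Radon-Nikodym derivative is determined only almost everywhere; it agrees with the density
   because both have the same integral over every measurable set. *)
- apply: ae_eqe_mul2l => /=.
  rewrite Radon_NikodymE//=; first exact: normal_prob_dominates.
  move=> dom; case: cid => /= h [h1 h2 h3].
  apply: integral_ae_eq => //=.
  + by apply/measurable_EFinP; exact: measurable_normal_pdf.
  + by move=> E _ mE; rewrite -h3.
Qed.

(** Truncation at height [n] reduces to the bounded case, and monotone convergence applies on both
    sides. *)
Lemma ge0_integral_normal_prob m s f : measurable_fun setT f ->
  (forall x, 0 <= f x)%R ->
  \int[normal_prob m s]_x (f x)%:E =
  \int[mu]_x (f x * normal_pdf m s x)%:E.
Proof.
move=> mf f0; pose g n x := Num.min (f x) n%:R.
have mg n : measurable_fun setT (g n) by exact: measurable_minr.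
have g0 n x : (0 <= g n x)%R by rewrite le_min f0 ler0n.
have ndg n k x : (n <= k)%N -> (g n x <= g k x)%R.
  by move=> nk; rewrite /g le_min !ge_min lexx /= ler_nat nk orbT.
have gf x : g ^~ x @ \oo --> f x.
  apply: cvg_near_cst; near=> n; apply/min_idPl.
  by near: n; exact: nbhs_infty_ger.
have E1 : \int[normal_prob m s]_x (g n x)%:E @[n --> \oo] -->
    \int[normal_prob m s]_x (f x)%:E.
  have -> : (fun x => (f x)%:E) = (fun x => limn (fun n => (g n x)%:E)).
    apply/funext => x; apply/esym/cvg_lim => //.
    by apply/fine_cvgP; split; [exact: nearW|exact: gf].
  apply: cvg_monotone_convergence => //.
  - by move=> n; apply/measurable_EFinP; exact: mg.
  - by move=> n x _; rewrite lee_fin.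
  - by move=> x _ n k nk; rewrite lee_fin ndg.
have E2 : \int[mu]_x (g n x * normal_pdf m s x)%:E @[n --> \oo] -->
    \int[mu]_x (f x * normal_pdf m s x)%:E.
  have -> : (fun x => (f x * normal_pdf m s x)%:E) =
      (fun x => limn (fun n => (g n x * normal_pdf m s x)%:E)).
    apply/funext => x; apply/esym/cvg_lim => //.
    apply/fine_cvgP; split; first exact: nearW.
    by apply: cvgMr_tmp; exact: gf.
  apply: cvg_monotone_convergence => //.
  - move=> n; apply/measurable_EFinP; apply: measurable_funM; first exact: mg.
    exact: measurable_normal_pdf.
  - by move=> n x _; rewrite lee_fin mulr_ge0// normal_pdf_ge0.
  - move=> x _ n k nk; rewrite lee_fin ler_wpM2r ?normal_pdf_ge0//.
    exact: ndg.
rewrite -(cvg_lim _ E1)// -(cvg_lim _ E2)//; congr (limn _); apply/funext => n.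
apply: (@bounded_integral_normal_prob _ _ _ n%:R) => // x.
by rewrite ger0_norm// /g ge_min lexx orbT.
Unshelve. all: by end_near. Qed.

(** Folding the negative half-line onto the positive one gives a sum of two integrals that is
    symmetric under the change of sign. *)
Let integral_opp G : continuous G -> (forall x, 0 <= G x)%R ->
  \int[mu]_x (G (- x)%R)%:E = \int[mu]_x (G x)%:E.
Proof.
have split_ G' : continuous G' -> (forall x, 0 <= G' x)%R ->
  \int[mu]_x (G' x)%:E = \int[mu]_(x in `[0%R, +oo[) (G' (- x)%R)%:E
    + \int[mu]_(x in `[0%R, +oo[) (G' x)%:E.
  move=> cG G0; have mG : measurable_fun [set: R] G'.
    exact: continuous_measurable_fun.
  rewrite -(@setUv _ `[0%R, +oo[%classic) ge0_integral_setU//= ; last 4 first.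
    exact: measurableC.
    by apply/measurable_EFinP; rewrite setUv.
    by move=> x _; rewrite lee_fin.
    exact/disj_setPCl.
  rewrite addeC; congr +%E.
  rewrite setCitvr integral_itv_bndo_bndc; last first.
    exact/measurable_EFinP/measurable_funTS.
  rewrite -{1}oppr0 ge0_integration_by_substitutionNy//.
  exact: continuous_subspaceT.
move=> cG G0; rewrite (split_ G)// (split_ (G \o -%R))//=; last first.
  by move=> x; apply: continuous_comp; [exact: opp_continuous|exact: cG].
by under eq_integral do rewrite opprK; rewrite addeC.
Qed.

Lemma integral_normal_prob_affine m s G : (0 < s)%R -> continuous G ->
  (forall x, 0 <= G x)%R ->
  \int[normal_prob m s]_x (G x)%:E =
  \int[normal_prob 0 1]_x (G (m + s * x)%R)%:E.
Proof.
move=> s0 cG G0.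
have cF : continuous (fun x => m + s * x)%R.
  by move=> x; apply: cvgD; [exact: cvg_cst|apply: cvgMl_tmp; exact: cvg_id].
have cGF : continuous (fun x => G (m + s * x)%R).
  by move=> x; apply: continuous_comp; [exact: cF|exact: cG].
rewrite !ge0_integral_normal_prob//; last 2 first.
  exact: continuous_measurable_fun.
  exact: continuous_measurable_fun.
have sN0 : (s != 0)%R by rewrite gt_eqF.
pose F (x : R) : R := (x * s + m)%R.
have dM x : derivable ( *%R^~ s : R -> R) x 1 by exact: derivableM.
have dF x : derivable F x 1 by exact: derivableD.
have F'E : F^`()%classic = cst s.
  apply/funext => x; rewrite derive1E deriveD// derive_cst addr0.
  by rewrite deriveM// derive_cst derive_id scaler0 add0r /= scaler1.
rewrite (@increasing_ge0_integration_by_substitutionT _ F); last 9 first.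
- by move=> x y xy; rewrite /F ltrD2r ltr_pM2r.
- by rewrite F'E => ?; exact: cvg_cst.
- by rewrite F'E; exact: is_cvg_cst.
- by rewrite F'E; exact: is_cvg_cst.
- exact: dF.
- exact: cvg_comp (gt0_cvgMlNy s0 cvg_id) (cvg_addrr_Ny m).
- exact: cvg_comp (gt0_cvgMly s0 cvg_id) (cvg_addrr m).
- move=> x; apply: cvgM; first exact: cG.
  exact: continuous_normal_pdf.
- by move=> x; rewrite mulr_ge0// normal_pdf_ge0.
apply: eq_integral => x _; congr EFin; rewrite F'E !fctE -mulrA.
have -> : F x = (m + s * x)%R by rewrite /F; ring.
(* The Jacobian [s] cancels the factor [s] in the normalization of the density. *)
congr (_ * _)%R; rewrite !normal_pdfE// /normal_peak /normal_fun.
have -> : (m + s * x - m = s * x)%R by ring.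
rewrite subr0 -mulrnAr sqrtrM ?sqr_ge0// sqrtr_sqr gtr0_norm// expr1n mul1r.
rewrite invfM mulrC !mulrA divff// mul1r; congr (_ * expR _)%R.
by field.
Qed.

(** By symmetry of the standard normal law. This removes the cross term from second moments while
    all integrands stay nonnegative. *)
Lemma integral_normal_prob_even G : continuous G ->
  (forall x, 0 <= G x)%R ->
  \int[normal_prob 0 1]_x (G x)%:E =
  \int[normal_prob 0 1]_x ((G x + G (- x)) / 2)%:E.
Proof.
move=> cG G0; have cGN : continuous (fun x => G (- x))%R.
  by move=> x; apply: continuous_comp; [exact: opp_continuous|exact: cG].
have mG : measurable_fun setT G by exact: continuous_measurable_fun.
have mGN : measurable_fun setT (fun x => G (- x)%R).
  exact: continuous_measurable_fun.
have GN : \int[normal_prob 0 1]_x (G (- x)%R)%:E = \int[normal_prob 0 1]_x (G x)%:E.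
  rewrite !ge0_integral_normal_prob// -[RHS]integral_opp//.
  - apply: eq_integral => x _; congr (_ * _)%:E; rewrite !normal_pdfE//.
    by rewrite /normal_fun !subr0 sqrrN.
  - move=> x; apply: cvgM; first exact: cG.
    by apply: continuous_normal_pdf; rewrite oner_neq0.
  - by move=> x; rewrite mulr_ge0// normal_pdf_ge0.
have h0 : (0 <= 2^-1 :> R)%R by rewrite invr_ge0.
under [RHS]eq_integral do rewrite mulrC EFinM EFinD.
rewrite ge0_integralZl//; last 2 first.
- by apply: emeasurable_funD; exact/measurable_EFinP.
- by move=> x _; rewrite adde_ge0// lee_fin.
rewrite ge0_integralD//; last 4 first.
- by move=> x _; rewrite lee_fin.
- exact/measurable_EFinP.
- by move=> x _; rewrite lee_fin.
- exact/measurable_EFinP.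
rewrite GN ge0_muleDr; last 2 first.
- by apply: integral_ge0 => x _; rewrite lee_fin.
- by apply: integral_ge0 => x _; rewrite lee_fin.
by rewrite -ge0_muleDl// -EFinD -div1r -splitr mul1e.
Qed.

End normal_integral.

(** * Functions of a centered Gaussian variable *)

Section gaussian_expectation.
Set Implicit Arguments.
Unset Strict Implicit.
Variable R : realType.
Local Open Scope ereal_scope.

Let M2 : \bar R := \int[normal_prob 0 1]_x (x ^+ 2)%:E.

Let measurable_sqr : measurable_fun setT (fun x : R => x ^+ 2)%R.
Proof. exact: measurable_funX. Qed.

(** A zero second moment would put all the mass at 0, whereas a law with a density gives no mass to
    a point. *)
Let M2_neq0 : M2 != 0.
Proof.
apply/negP => /eqP M0.
have : \int[normal_prob 0 1]_x `|(x ^+ 2)%:E| = 0 :> \bar R.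
  by rewrite -[RHS]M0; apply: eq_integral => x _; rewrite gee0_abs// lee_fin sqr_ge0.
move/(ae_eq_integral_abs (normal_prob 0 1) measurableT).
rewrite -/(measurable_fun _ _) => /(_ _)[|N [mN N0 sub]].
  exact/measurable_EFinP.
have : normal_prob (0 : R) 1 [set~ 0%R] = 0.
  apply: (subset_measure0 _ mN) => //; first exact: measurableC.
  move=> x /= x0; apply: sub => /= /(_ I) /eqP.
  by rewrite eqe sqrf_eq0 => /eqP.
rewrite probability_setC// [X in 1 - X](_ : _ = 0); last first.
  exact: integral_set1.
by rewrite sube0 => /eqP; rewrite eqe oner_eq0.
Qed.

(* The variance of the standard normal law: that it is nonzero suffices, its
   value 1 is never needed. *)
Definition normal_var : R := fine M2.

Variables (d : measure_display) (T : measurableType d).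
Variables (P : probability T R) (Z : T -> R) (v : R).
Hypothesis gZ : gaussian_rv P Z.
Hypothesis EZ : \int[P]_w (Z w)%:E = 0.
Hypothesis EZ2 : \int[P]_w (Z w ^+ 2)%:E = v%:E.

(** The degenerate case [s = 0] is included: the law is then a Dirac mass and the right-hand side is
    the expectation of a constant. *)
Let affine_law : exists mu s : R, (0 <= s)%R /\
  forall G : R -> R, continuous G -> (forall x, 0 <= G x)%R ->
  \int[P]_w (G (Z w))%:E = \int[normal_prob 0 1]_x (G (mu + s * x)%R)%:E.
Proof.
have [mZ [mu [s [s0 law]]]] := gZ; exists mu, s; split=> // G cG G0.
pose Z' : T -> measurableTypeR R := Z.
have mZ' : measurable_fun setT Z' by exact: mZ.
have mG : measurable_fun [set: measurableTypeR R] (fun x => (G x)%:E).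
  by apply/measurable_EFinP; exact: continuous_measurable_fun.
transitivity (\int[pushforward P Z']_x (G x)%:E).
  by rewrite ge0_integral_pushforward// => x _; rewrite lee_fin.
have [s_eq0|sN0] := eqVneq s 0%R.
  rewrite (eq_measure_integral \d_(mu : measurableTypeR R))/=; last first.
    by move=> A mA _; rewrite [LHS]law// /gaussian_law s_eq0 eqxx.
  rewrite integral_dirac// diracT mul1e.
  transitivity (\int[normal_prob 0 1]_(x in [set: measurableTypeR R]) (G mu)%:E).
    by rewrite integral_cst//= probability_setT mule1.
  by apply: eq_integral => x _; rewrite s_eq0 mul0r addr0.
rewrite [LHS](eq_measure_integral (normal_prob mu s))/=; last first.
  by move=> A mA _; rewrite [LHS]law// /gaussian_law (negbTE sN0).
by rewrite integral_normal_prob_affine// lt_neqAle eq_sym sN0.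
Qed.

Let continuous_sqr_shift (a : R) : continuous (fun x : R => (x + a) ^+ 2)%R.
Proof.
move=> x; apply: (@continuous_comp _ _ _ (fun x : R => x + a)%R (fun x : R => x ^+ 2)%R).
  by apply: cvgD; [exact: cvg_id|exact: cvg_cst].
exact: exprn_continuous.
Qed.

(** Symmetrization removes the cross term. The identity is between extended reals, the finiteness of
    [M2] being established only later. *)
Let normal_quad (a b : R) :
  \int[normal_prob 0 1]_x ((a + b * x) ^+ 2)%:E =
  (a ^+ 2)%:E + (b ^+ 2)%:E * M2.
Proof.
rewrite integral_normal_prob_even; last 2 first.
- move=> x; apply: (@continuous_comp _ _ _ (fun x : R => a + b * x)%R
    (fun x : R => x ^+ 2)%R).
    by apply: cvgD; [exact: cvg_cst|apply: cvgMl_tmp; exact: cvg_id].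
  exact: exprn_continuous.
- by move=> x; rewrite sqr_ge0.
under eq_integral => x _.
  have -> : (((a + b * x) ^+ 2 + (a + b * - x) ^+ 2) / 2 =
    a ^+ 2 + b ^+ 2 * x ^+ 2)%R by field.
  rewrite EFinD (EFinM (b ^+ 2)); over.
rewrite ge0_integralD//.
- congr (_ + _); first by rewrite integral_cst//= probability_setT mule1.
  rewrite ge0_integralZl//.
  + exact/measurable_EFinP.
  + by move=> x _; rewrite lee_fin sqr_ge0.
  + by rewrite lee_fin sqr_ge0.
- by move=> x _; rewrite lee_fin sqr_ge0.
- by move=> x _; rewrite -EFinM lee_fin mulr_ge0// sqr_ge0.
- by apply/measurable_EFinP; exact: measurable_funM.
Qed.

Let shifted_moment (a : R) : \int[P]_w ((Z w + a) ^+ 2)%:E = (v + a ^+ 2)%:E.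
Proof.
have [mZ _] := gZ.
(* A measurable function whose integral is finite is integrable, since its positive and negative
   parts then have finite integrals. *)
have iZ : P.-integrable setT (fun w => (Z w)%:E).
  apply/integrableP; split; first exact/measurable_EFinP.
  by rewrite integral_fin_num_abs// EZ.
have iZ2 : P.-integrable setT (fun w => (Z w ^+ 2)%:E).
  have mZ2 : measurable_fun setT (fun w => Z w ^+ 2)%R by exact: measurable_funX.
  apply/integrableP; split; first exact/measurable_EFinP.
  by rewrite integral_fin_num_abs// EZ2.
under eq_integral => w _.
  have -> : ((Z w + a) ^+ 2 = Z w ^+ 2 + (2 * a * Z w + a ^+ 2))%R by ring.
  rewrite !EFinD (EFinM (2 * a)); over.
rewrite integralD//=; last 1 first.
  apply: integrableD => //; first exact: integrableZl.
  exact: finite_measure_integrable_cst.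
rewrite integralD//=; last 2 first.
- exact: integrableZl.
- exact: finite_measure_integrable_cst.
by rewrite EZ2 integralZl// EZ mule0 add0e integral_cst//= probability_setT mule1.
Qed.

(** Comparing the second moments of [Z + a] and [mu + a + s * x], with [x] standard normal, for two
    values of [a] identifies both parameters: [mu = 0] and [s ^+ 2 * M2 = v]. *)
Lemma gaussian_expectation (G : R -> R) : continuous G -> (forall x, 0 <= G x)%R ->
  \int[P]_w (G (Z w))%:E =
  \int[normal_prob 0 1]_x (G (Num.sqrt (v / normal_var) * x)%R)%:E.
Proof.
have [mu [s [s0 law]]] := affine_law.
have quad a : (v + a ^+ 2)%:E = ((mu + a) ^+ 2)%:E + (s ^+ 2)%:E * M2.
  rewrite -shifted_moment -normal_quad (law (fun x => (x + a) ^+ 2)%R)//.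
    by apply: eq_integral => x _; rewrite addrAC.
  by move=> x; rewrite sqr_ge0.
have [w wE] : exists w : R, (s ^+ 2)%:E * M2 = w%:E.
  have := quad 0%R; case: (_ * M2) => [w _|//|//]; by exists w.
have q a : (v + a ^+ 2 = (mu + a) ^+ 2 + w)%R.
  by have := quad a; rewrite wE -EFinD => -[].
have mu0 : mu = 0%R.
  (* Subtracting the identities at [a = 0] and [a = 1] leaves [2 * mu = 0]. *)
  by have := q 0%R; have := q 1%R; rewrite !addr0 expr0n/= => h1 h0; nra.
have vw : v = w by have := q 0%R; rewrite mu0 !addr0 expr0n/= addr0 add0r.
suff -> : Num.sqrt (v / normal_var) = s.
  by move=> cG G0; rewrite law// mu0; apply: eq_integral => x _; rewrite add0r.
rewrite vw; have [s_eq0|sN0] := eqVneq s 0%R.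
  (* In the extended reals [0 * M2 = 0] even for infinite [M2], hence [v = 0]. *)
  move: wE; rewrite s_eq0 expr0n/= mul0e => -[<-].
  by rewrite mul0r sqrtr0.
(* A nonzero [s] turns the finiteness of [s ^+ 2 * M2] into that of [M2]. *)
have M2fin : M2 \is a fin_num.
  have s20 : (0 < s ^+ 2)%R by rewrite exprn_even_gt0.
  have : (s ^+ 2)%:E * M2 \is a fin_num by rewrite wE.
  have : 0 <= M2 by apply: integral_ge0 => x _; rewrite lee_fin sqr_ge0.
  by move: M2 => [r| |] // _; rewrite gt0_muley.
have nvE : M2 = normal_var%:E by rewrite fineK.
have nv0 : normal_var != 0%R by have := M2_neq0; rewrite nvE eqe.
move: wE; rewrite nvE -EFinM => -[<-].
by rewrite mulfK// sqrtr_sqr ger0_norm.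
Qed.

End gaussian_expectation.

Section normal_char.
Set Implicit Arguments.
Unset Strict Implicit.
Variables (R : realType) (th : R).
Local Open Scope ereal_scope.

(* The shift by 1 makes the integrand nonnegative, as the change of variables
   for [normal_prob] requires. *)
Definition normal_cos (s : R) : \bar R :=
  \int[normal_prob 0 1]_x (1 + cos (s * x + th))%:E.

Lemma cvg_normal_cos (s_ : nat -> R) (s : R) : s_ @ \oo --> s ->
  normal_cos (s_ n) @[n --> \oo] --> normal_cos s.
Proof.
move=> s_s.
have [|||//] := @bounded_cvg_integral _ _ _ (normal_prob 0 1)
  (fun n x => 1 + cos (s_ n * x + th))%R (fun x => 1 + cos (s * x + th))%R 2%R.
- move=> n; apply: measurable_funD => //; apply: measurableT_comp.
    by apply: continuous_measurable_fun; exact: continuous_cos.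
  by apply: measurable_funD => //; exact: measurable_funM.
- by move=> n x; rewrite ler_norml; apply/andP; have := cos_le1 (s_ n * x + th);
    have := cos_geN1 (s_ n * x + th); split; lra.
- move=> x; apply: cvgD; first exact: cvg_cst.
  apply: continuous_cvg; first exact: continuous_cos.
  by apply: cvgD; [exact: cvgMr_tmp|exact: cvg_cst].
Qed.

End normal_char.

(** * Riemann sums *)

Section riemann.
Set Implicit Arguments.
Unset Strict Implicit.
Variable R : realType.
Implicit Types (f : R -> R) (a b c e x y : R).
Local Notation mu := (@lebesgue_measure R).

(** Half of the continuity radius at [x] serves all points near [x]; the near-covering form of
    compactness turns these local choices into a single [dl]. *)
Lemma within_unif_continuous f a b e : {within `[a, b], continuous f} -> 0 < e ->
  exists2 dl : R, 0 < dl & forall x y, x \in `[a, b] -> y \in `[a, b] ->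
    `|x - y| < dl -> `|f x - f y| < e.
Proof.
move=> cf e0.
have /compact_near_coveringP cov := @segment_compact R a b.
pose Q (dl : R) x := x \in `[a, b] -> forall y, y \in `[a, b] ->
   `|x - y| < dl -> `|f x - f y| < e.
have : \forall dl \near (0 : R)^'+, `[a, b]%classic `<=` Q dl.
  apply: cov => x xab.
  have /(_ x xab)/cvgrPdist_lt/(_ (e / 2)) :=
    (@subspace_continuousP _ `[a, b]%classic _ f).1 cf.
  rewrite divr_gt0// => /(_ erefl); rewrite near_withinE => /nbhs_ballP[r /= r0 hr].
  have r20 : 0 < r / 2 by rewrite divr_gt0.
  near=> x' dl => x'ab y yab x'y.
  have xx' : `|x - x'| < r / 2 by near: x'; exact: nbhsx_ballx.
  have dlr : dl < r / 2 by near: dl; exact: nbhs_right_lt.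
  have h1 : `|f x - f x'| < e / 2.
    by apply: hr => //=; apply: lt_trans xx' _; rewrite ltr_pdivrMr//; lra.
  have h2 : `|f x - f y| < e / 2.
    apply: hr => //=; apply: le_lt_trans (ler_distD x' _ _) _.
    by rewrite [ltRHS]splitr; apply: ltrD xx' _; exact: lt_trans x'y dlr.
  apply: le_lt_trans (ler_distD (f x) _ _) _.
  by rewrite distrC [ltRHS]splitr; exact: ltrD.
move=> /filterS-/(_ _ (fun=> id)) h.
have : \forall dl \near (0 : R)^'+, 0 < dl /\ `[a, b]%classic `<=` Q dl.
  by near=> dl; split; near: dl => //; exact: nbhs_right_gt.
move=> /filter_ex[dl [dl0 hdl]]; exists dl => // x y xab yab xy.
exact: hdl.
Unshelve. all: by end_near. Qed.

Let integral_near_const f a b c e : a <= b -> mu.-integrable `[a, b] (EFin \o f) ->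
  (forall x, x \in `[a, b] -> `|f x - c| <= e) ->
  `|\int[mu]_(x in `[a, b]) f x - c * (b - a)| <= e * (b - a).
Proof.
move=> ab fi fc.
have cstE k : \int[mu]_(x in `[a, b]) (cst k x) = k * (b - a).
  rewrite Rintegral_cst//= lebesgue_measure_itv/= lte_fin.
  move: ab; rewrite le_eqVlt => /predU1P[->|->//].
  by rewrite ltxx subrr.
have cst_i k : mu.-integrable `[a, b] (EFin \o cst k).
  apply: continuous_compact_integrable; first exact: segment_compact.
  by apply: continuous_subspaceT => x; exact: cvg_cst.
have h1 : \int[mu]_(x in `[a, b]) f x <= (c + e) * (b - a).
  rewrite -cstE; apply: le_Rintegral => // x /fc.
  by rewrite ler_norml => /andP[_]; rewrite /= lerBlDl.
have h2 : (c - e) * (b - a) <= \int[mu]_(x in `[a, b]) f x.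
  rewrite -cstE; apply: le_Rintegral => // x /fc.
  by rewrite ler_norml => /andP[+ _]; rewrite /= lerBrDr addrC.
by rewrite ler_norml lerBrDr addrC -mulrBl h2 lerBlDr addrC -mulrDl.
Qed.

Definition riemann_sum f n := n.+1%:R^-1 * \sum_(i < n.+1) f (i%:R / n.+1%:R).

(** Each of the [n.+1] cells contributes an error of at most [e / n.+1%:R]. The bound sees [f] only
    through its modulus of continuity, which later makes it uniform over the sections of a
    kernel. *)
Lemma riemann_sum_le f n e : mu.-integrable `[0, 1] (EFin \o f) ->
  (forall x y, x \in `[0, 1] -> y \in `[0, 1] -> `|x - y| <= n.+1%:R^-1 ->
    `|f x - f y| <= e) ->
  `|\int[mu]_(x in `[0, 1]) f x - riemann_sum f n| <= e.
Proof.
move=> fi fe; set h : R := n.+1%:R^-1; have h0 : 0 < h by rewrite invr_gt0.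
have hn : n.+1%:R * h = 1 by rewrite divff.
have sub k : (k <= n.+1)%N -> 0 <= k%:R * h <= 1.
  move=> kn; apply/andP; split; first by rewrite mulr_ge0// ltW.
  by rewrite -[leRHS]hn ler_wpM2r ?ler_nat// ltW.
have step k : (k <= n.+1)%N ->
    `|\int[mu]_(x in `[0, k%:R * h]) f x - h * \sum_(i < k) f (i%:R * h)|
    <= e * (k%:R * h).
  elim: k => [_|k ih kn].
    by rewrite mul0r big_ord0 set_itv1 Rintegral_set1 !mulr0 subrr normr0.
  have /andP[k0 k1] := sub k (ltnW kn); have /andP[Sk0 Sk1] := sub _ kn.
  have kSk : k%:R * h <= k.+1%:R * h.
    by rewrite ler_wpM2r ?ler_nat// ltW.
  have fi' u v : 0 <= u -> v <= 1 -> mu.-integrable `[u, v] (EFin \o f).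
    move=> u0 v1; apply: integrableS fi => //; by apply: subset_itv; rewrite bnd_simp.
  (* Additivity leaves the half-open last cell, whose integral is that of the closed one. *)
  have E := @Rintegral_itvB _ f (BLeft 0) (BRight (k.+1%:R * h)) (k%:R * h)
    (fi' _ _ (lexx _) Sk1).
  rewrite !bnd_simp in E; move: (E k0 kSk) => {}E.
  rewrite Rintegral_itv_obnd_cbnd in E; last first.
    apply: integrableS (fi' _ _ k0 Sk1) => //; apply: subset_itvr.
    by rewrite bnd_simp.
  have hE : k.+1%:R * h - k%:R * h = h by rewrite -natr1; ring.
  have last_bound : `|\int[mu]_(x in `[k%:R * h, k.+1%:R * h]) f x
      - f (k%:R * h) * h| <= e * h.
    rewrite -{4 5}hE; apply: integral_near_const => //; first exact: fi'.
    move=> x; rewrite in_itv/= => /andP[kx xk]; apply: fe.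
    - by rewrite in_itv/= (le_trans k0 kx) (le_trans xk Sk1).
    - by rewrite in_itv/= k0.
    - by rewrite ger0_norm ?subr_ge0// lerBlDl (le_trans xk)// -natr1 mulrDl mul1r.
  have {}ih := ih (ltnW kn).
  rewrite big_ord_recr/=.
  rewrite (_ : _ - _ = (\int[mu]_(x in `[0, k%:R * h]) f x
      - h * \sum_(i < k) f (i%:R * h))
    + (\int[mu]_(x in `[k%:R * h, k.+1%:R * h]) f x - f (k%:R * h) * h)).
    apply: le_trans (ler_normD _ _) _; apply: le_trans (lerD ih last_bound) _.
    by rewrite -natr1 mulrDl mul1r mulrDr.
  by rewrite -E; ring.
by have := step n.+1 (leqnn _); rewrite hn mulr1.
Qed.

Lemma cvg_riemann_sum f : {within `[0, 1], continuous f} ->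
  riemann_sum f n @[n --> \oo] --> \int[mu]_(x in `[0, 1]) f x.
Proof.
move=> cf; apply/cvgrPdist_le => e e0.
have [dl dl0 h] := within_unif_continuous cf e0.
near=> n; apply: riemann_sum_le.
  by apply: continuous_compact_integrable => //; exact: segment_compact.
move=> x y x01 y01 xy; apply/ltW/h => //; apply: le_lt_trans xy _.
near: n; exact: (near_infty_natSinv_lt (PosNum dl0)).
Unshelve. all: by end_near. Qed.

End riemann.

(** * The covariance kernel of the time-changed bridge *)

Section poly_calculus.
Set Implicit Arguments.
Unset Strict Implicit.
Variable R : realType.
Local Notation mu := (@lebesgue_measure R).

Lemma poly_antideriv (p : {poly R}) : exists q : {poly R}, q^`() = p /\ q.[0] = 0.
Proof.
exists (\sum_(i < size p) (p`_i / i.+1%:R) *: 'X^(i.+1)); split; last first.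
  rewrite horner_sum big1// => i _.
  by rewrite hornerZ hornerXn expr0n/= mulr0.
rewrite linear_sum/= -[RHS]coefK poly_def.
apply: eq_bigr => i _; rewrite derivZ derivXn -scalerMnr scalerMnl.
by rewrite -[X in X *: _]mulr_natr divfK.
Qed.

Lemma deriv_poly_inj (p q : {poly R}) : p^`() = q^`() -> p.[0] = q.[0] -> p = q.
Proof.
move=> pq; rewrite !horner_coef0 => pq0; apply/polyP => -[//|i].
have := congr1 (fun r : {poly R} => r`_i) pq; rewrite !coef_deriv => /eqP.
by rewrite -subr_eq0 -mulrnBl mulrn_eq0/= subr_eq0 => /eqP.
Qed.

Lemma Rintegral_poly (p : {poly R}) (a b : R) : a <= b ->
  \int[mu]_(x in `[a, b]) p^`().[x] = p.[b] - p.[a].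
Proof.
rewrite le_eqVlt => /predU1P[->|ab]; first by rewrite set_itv1 Rintegral_set1 subrr.
rewrite /Rintegral (@continuous_FTC2 _ (horner p^`()) (horner p))//.
- by apply: continuous_subspaceT; exact: continuous_horner.
- split.
  + by move=> x _; exact: derivable_horner.
  + by apply: cvg_at_right_filter; exact: continuous_horner.
  + by apply: cvg_at_left_filter; exact: continuous_horner.
- by move=> x _; rewrite derivE.
Qed.

Lemma integrable_horner (p : {poly R}) a b :
  mu.-integrable `[a, b] (fun x => p.[x]%:E).
Proof.
apply: (@continuous_compact_integrable _ (horner p)); first exact: segment_compact.
by apply: continuous_subspaceT; exact: continuous_horner.
Qed.

End poly_calculus.

(** * The Beta distribution function and the integral of its bridge kernel *)

Section beta_cdf.
Set Implicit Arguments.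
Unset Strict Implicit.
Variables (R : realType) (k : nat).
Local Notation mu := (@lebesgue_measure R).
Local Notation m := k.+1.
Local Notation H := (@beta_cdf R m).

Definition beta_norm : R := ((2 * m - 1)`!)%:R / ((m - 1)`!)%:R ^+ 2.

Local Notation C := beta_norm.

Let xy : {poly R} := 'X * (1 - 'X).

Let xyE x : xy.[x] = x * (1 - x).
Proof. by rewrite /xy !hornerE. Qed.

Let C_gt0 : 0 < C.
Proof. by rewrite divr_gt0// ?exprn_gt0// ltr0n fact_gt0. Qed.

Let Rintegral_xy j : \int[mu]_(x in `[0, 1]) (xy ^+ j).[x] =
  (j`! * j`!)%:R / (j + j).+1`!%:R.
Proof.
rewrite -beta_fun_fact /beta_fun -Rintegral_mkcond; apply: eq_Rintegral => x _.
by rewrite horner_exp xyE exprMn.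
Qed.

(** Reduces the later integrals to derivatives of polynomials. The value at 1 is Euler's Beta
    integral. For negative [x] the integral defining [H x] runs over an empty interval, hence the
    restriction to [0 <= x]. *)
Lemma beta_cdf_poly : exists p : {poly R}, [/\ p^`() = C *: xy ^+ k, p.[0] = 0,
  p.[1] = 1 & forall x, 0 <= x -> H x = p.[x]].
Proof.
have [q [q' q0]] := poly_antideriv (xy ^+ k).
have qE x : 0 <= x -> q.[x] = \int[mu]_(t in `[0, x]) (xy ^+ k).[t].
  by move=> x0; rewrite -q' Rintegral_poly// q0 subr0.
have Hq x : 0 <= x -> H x = C * q.[x].
  move=> x0; rewrite /beta_cdf -/beta_norm; congr (_ * _).
  rewrite qE//; apply: eq_Rintegral => t _.
  by rewrite horner_exp xyE exprMn subn1.
exists (C *: q); split.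
- by rewrite derivZ q'.
- by rewrite hornerZ q0 mulr0.
- rewrite hornerZ qE// Rintegral_xy /beta_norm.
  rewrite (_ : (2 * m - 1 = (k + k).+1)%N); last by lia.
  rewrite subn1 natrM /=.
  by field; rewrite !pnatr_eq0 -!lt0n !fact_gt0.
- by move=> x /Hq ->; rewrite hornerZ.
Qed.

Lemma beta_cdf_homo (x y : R) : 0 <= x -> x <= y -> y <= 1 -> H x <= H y.
Proof.
have [p [p' _ _ pH]] := beta_cdf_poly.
move=> x0 xy' y1; rewrite !pH ?(le_trans x0)// -subr_ge0 -Rintegral_poly//.
apply: Rintegral_ge0 => t /=; rewrite in_itv/= => /andP[xt ty].
rewrite p' hornerZ horner_exp xyE mulr_ge0 ?(ltW C_gt0)// exprn_ge0//.
by rewrite mulr_ge0// ?subr_ge0; [exact: le_trans xt|exact: le_trans y1].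
Qed.

Lemma beta_cdf_itv (x : R) : x \in `[0, 1] -> H x \in `[0, 1].
Proof.
have [p [_ p0 p1 pH]] := beta_cdf_poly.
rewrite !in_itv/= => /andP[x0 x1].
have H0 : H 0 = 0 by rewrite pH.
have H1 : H 1 = 1 by rewrite pH.
by apply/andP; split; [rewrite -[leLHS]H0|rewrite -[leRHS]H1]; exact: beta_cdf_homo.
Qed.

Definition beta_cov (s t : R) : R := Num.min (H s) (H t) - H s * H t.

Lemma continuous_beta_cdf : {within `[0, 1], continuous H}.
Proof.
have [p [_ _ _ pH]] := beta_cdf_poly.
apply: (@subspace_eq_continuous _ _ _ (horner p)).
  move=> x /set_mem x01; have x0 : 0 <= x by move: x01; rewrite /= in_itv => /andP[].
  exact: (esym (pH _ x0)).
by apply: continuous_subspaceT; exact: continuous_horner.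
Qed.

Lemma continuous_beta_cov t : {within `[0, 1], continuous (beta_cov ^~ t)}.
Proof.
have cH := continuous_beta_cdf.
move=> s; apply: cvgB; last by apply: cvgMr_tmp; exact: cH.
have h : {for s, continuous (H : subspace `[0, 1] -> R^o)} by exact: cH.
have := @continuous_min _ _ _ (cst (H t)) s h; apply; exact: cvg_cst.
Qed.

(** Let K be the antiderivative of H vanishing at 0. Splitting at s = u gives K(u) + H(u) (1 - u -
    K(1)), with derivative H'(u) (1 - u - K(1)). The claimed value has derivative H'(u) (1/2 - u),
    so it remains to see that K(1) = 1/2. *)
Lemma Rintegral_beta_cov (t : R) : t \in `[0, 1] ->
  \int[mu]_(s in `[0, 1]) beta_cov s t = C / (2 * m%:R) * (t * (1 - t)) ^+ m.
Proof.
have [p [p' p0 p1 pH]] := beta_cdf_poly.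
have [K [K' K0]] := poly_antideriv p.
have split_int (u : R) : u \in `[0, 1] ->
    \int[mu]_(s in `[0, 1]) beta_cov s u = K.[u] + p.[u] * (1 - u - K.[1]).
  rewrite in_itv/= => /andP[u0 u1].
  have cov_lo (s : R) : s \in `[0, u] -> beta_cov s u = ((1 - p.[u]) *: K)^`().[s].
    rewrite in_itv/= => /andP[s0 su]; rewrite /beta_cov min_l ?beta_cdf_homo//.
    by rewrite !pH// derivZ K' hornerZ; ring.
  have cov_hi (s : R) : s \in `[u, 1] -> beta_cov s u = (p.[u] *: ('X - K))^`().[s].
    rewrite in_itv/= => /andP[us s1]; rewrite /beta_cov min_r ?beta_cdf_homo//.
    rewrite !pH ?(le_trans u0)// derivZ derivB derivX K' !hornerE; ring.
  have int_hi : mu.-integrable `[u, 1] (EFin \o beta_cov ^~ u).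
    apply: eq_integrable (@integrable_horner _ (p.[u] *: ('X - K))^`() u 1) => //.
    by move=> s; rewrite inE/= => /cov_hi ->.
  have int_all : mu.-integrable `[0, 1] (EFin \o beta_cov ^~ u).
    apply: continuous_compact_integrable; first exact: segment_compact.
    exact: continuous_beta_cov.
  have := @Rintegral_itvB _ (beta_cov ^~ u) (BLeft 0) (BRight 1) u int_all.
  rewrite !bnd_simp Rintegral_itv_obnd_cbnd; last first.
    by apply: integrableS int_hi => //; apply: subset_itvr; rewrite bnd_simp.
  have -> : \int[mu]_(s in `[0, u]) beta_cov s u = (1 - p.[u]) * K.[u].
    transitivity (\int[mu]_(s in `[0, u]) ((1 - p.[u]) *: K)^`().[s]).
      by apply: eq_Rintegral => s; rewrite inE/= => /cov_lo.
    by rewrite Rintegral_poly// !hornerZ K0; ring.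
  have -> : \int[mu]_(s in `[u, 1]) beta_cov s u =
      p.[u] * (1 - u - (K.[1] - K.[u])).
    transitivity (\int[mu]_(s in `[u, 1]) (p.[u] *: ('X - K))^`().[s]).
      by apply: eq_Rintegral => s; rewrite inE/= => /cov_hi.
    by rewrite Rintegral_poly// !hornerE; ring.
  by move=> /(_ u0 u1)/eqP; rewrite subr_eq => /eqP ->; ring.
pose W := (C / (2 * m%:R)) *: xy ^+ m.
(* Both sides vanish at 0 and have the same derivative; the multiple of [p] absorbs the still
   unknown [K.[1]]. *)
have rE : K + p * (1 - 'X - K.[1]%:P) = W + (2^-1 - K.[1]) *: p.
  apply: deriv_poly_inj; last first.
    by rewrite /W !hornerE ?horner_exp ?xyE K0 p0 !mul0r expr0n/= !mulr0 !addr0.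
  pose c2 : {poly R} := (2^-1)%:P.
  have c22 : c2 * 2%:R = 1 by rewrite -polyC_natr -polyCM mulVf.
  have cm : (C / (2 * m%:R))%:P * m%:R = C%:P * c2.
    by rewrite -polyC_natr -!polyCM; congr polyC; field.
  rewrite !poly.derivE deriv_exp K' p' !poly.derivE -/xy -!mul_polyC polyCB -/c2.
  rewrite -[X in _ = _ * X + _]mulr_natr -[m.-1]/k.
  transitivity (C%:P * xy ^+ k * (1 - 'X - K.[1]%:P)); first by ring.
  transitivity (((C / (2 * m%:R))%:P * m%:R) * ((1 - 'X * 2%:R) * xy ^+ k)
    + (c2 - K.[1]%:P) * (C%:P * xy ^+ k)); last by ring.
  rewrite cm; transitivity (C%:P * xy ^+ k *
    (c2 - 'X * (c2 * 2%:R) + (c2 - K.[1]%:P))); last by ring.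
  rewrite c22 -[X in X - 'X - _]c22; ring.
(* At 1 the left side of [rE] and [W] both vanish, while [p.[1] = 1]. *)
have K1 : K.[1] = 2^-1.
  have := congr1 (horner^~ 1) rE.
  rewrite /W !hornerE ?horner_exp ?xyE p1 subrr expr0n/= mulr0 add0r => h.
  lra.
move=> /split_int ->; have := congr1 (horner^~ t) rE.
by rewrite K1 /W !hornerE ?horner_exp ?xyE subrr mul0r addr0.
Qed.

(** This is Var I, the integral of r. Euler's integral contributes (m!)^2 / (2m+1)!, and the
    factorials cancel against C. *)
Lemma Rintegral_beta_cov_double :
  \int[mu]_(t in `[0, 1]) (C / (2 * m%:R) * (t * (1 - t)) ^+ m)
    = (4 * (2 * m + 1)%:R)^-1.
Proof.
under eq_Rintegral do rewrite -xyE -horner_exp.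
rewrite RintegralZl//; last exact: (@integrable_horner _ (xy ^+ m) 0 1).
rewrite Rintegral_xy /beta_norm.
have -> : ((m + m).+1`! = (2 * m + 1) * (2 * m * (2 * m - 1)`!))%N.
  by rewrite [(m + m)%N](_ : _ = (2 * m - 1).+1)%N ?factS; [congr (_ * (_ * _))%N|]; lia.
have -> : (m`! = m * (m - 1)`!)%N by rewrite factS subn1.
have F0 j : j`!%:R != 0 :> R by rewrite pnatr_eq0 -lt0n fact_gt0.
have m0 : m%:R != 0 :> R by rewrite pnatr_eq0.
have m1 : (2 * m + 1)%:R != 0 :> R by rewrite addn1 pnatr_eq0.
rewrite !natrM; move: m0 m1 (F0 (2 * m - 1)%N) (F0 (m - 1)%N).
move: (m%:R) ((2 * m + 1)%:R : R) ((2 * m - 1)`!%:R : R) ((m - 1)`!%:R : R).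
by move=> a b c e a0 b0 c0 e0; field; rewrite a0 b0 c0 e0.
Qed.

End beta_cdf.

(** * Gaussian processes with the kernel identity [r = (V / 2) g] *)

Section gaussian_reflection.
Set Implicit Arguments.
Unset Strict Implicit.
Variables (R : realType) (d : measure_display) (T : measurableType d).
Variables (P : probability T R) (X : R -> T -> R) (c : R -> R -> R) (g : R -> R).
Variable V : R.
Local Notation mu := (@lebesgue_measure R).
Local Notation D := (`[0, 1]%classic : set R).

Hypothesis gX : gaussian_process P D X.
Hypothesis EX : forall t, D t -> (\int[P]_w (X t w)%:E = 0)%E.
Hypothesis EXX : forall s t, D s -> D t ->
  (\int[P]_w (X s w * X t w)%:E = (c s t)%:E)%E.
Hypothesis cX : forall w, {within `[0, 1], continuous (X ^~ w)}.
Hypothesis cg : {within `[0, 1], continuous g}.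
Hypothesis cc : forall t, D t -> {within `[0, 1], continuous (c ^~ t)}.
Hypothesis uc : forall e : R, 0 < e -> exists2 dl : R, 0 < dl &
  forall t x y, D t -> D x -> D y -> `|x - y| < dl -> `|c x t - c y t| <= e.
(** Together with [VE] this makes [V] the iterated integral of [c], that is, the variance of the
    integral of [X]. *)
Hypothesis rE : forall t, D t ->
  \int[mu]_(s in `[0, 1]) c s t = V / 2 * g t.
Hypothesis VE : \int[mu]_(t in `[0, 1]) (V / 2 * g t) = V.

Let gauss_lin s : times_in D s -> gaussian_rv P (fun w => lin_eval s (X ^~ w)).
Proof.
move=> hs; pose tn (i : 'I_(size s)) := tnth (in_tuple s) i.
rewrite (_ : (fun w => _) = fun w => \sum_(i < size s) (tn i).1 * X (tn i).2 w).
  by apply: gX => i; apply: hs; exact: (mem_tnth i (in_tuple s)).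
by apply/funext => w; rewrite /lin_eval big_tnth.
Qed.

Let pX : is_process D X.
Proof.
move=> t Dt; have /gauss_lin[+ _] : times_in D [:: (1, t)].
  by move=> p; rewrite inE => /eqP ->.
by under eq_fun do rewrite /lin_eval big_seq1 mul1r.
Qed.

Let iX t : D t -> P.-integrable setT (fun w => (X t w)%:E).
Proof.
move=> Dt; apply/integrableP; split; first by apply/measurable_EFinP; exact: pX.
by rewrite integral_fin_num_abs// ?EX//; exact: pX.
Qed.

Let iXX s t : D s -> D t -> P.-integrable setT (fun w => (X s w * X t w)%:E).
Proof.
move=> Ds Dt; have mXX : measurable_fun setT (fun w => X s w * X t w).
  by apply: measurable_funM; exact: pX.
apply/integrableP; split; first exact/measurable_EFinP.
by rewrite integral_fin_num_abs// EXX.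
Qed.

Let cC s t : D s -> D t -> c s t = c t s.
Proof.
move=> Ds Dt; apply: EFin_inj; rewrite -!EXX//.
by apply: eq_integral => w _; rewrite mulrC.
Qed.

Let cov (s u : seq (R * R)) : R :=
  \sum_(p <- s) \sum_(q <- u) p.1 * q.1 * c p.2 q.2.

(** Integrability is part of the conclusion so that the lemma can be applied to its own output, as
    [var_lin] does for a double sum. *)
Let integral_sumZ n (a v : 'I_n -> R) (F : 'I_n -> T -> R) :
  (forall i, P.-integrable setT (fun w => (F i w)%:E)) ->
  (forall i, \int[P]_w (F i w)%:E = (v i)%:E)%E ->
  P.-integrable setT (fun w => (\sum_(i < n) a i * F i w)%:E) /\
  (\int[P]_w (\sum_(i < n) a i * F i w)%:E = (\sum_(i < n) a i * v i)%:E)%E.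
Proof.
move=> iF Fv; under eq_fun do rewrite -sumEFin.
have iaF i : P.-integrable setT (fun w => (a i * F i w)%:E).
  by under eq_fun do rewrite EFinM; exact: integrableZl.
split; first exact: integrable_sum.
rewrite integral_sum// -sumEFin; apply: eq_bigr => i _.
by under eq_integral do rewrite EFinM; rewrite integralZl// Fv.
Qed.

Let mean_lin s : times_in D s -> (\int[P]_w (lin_eval s (X ^~ w))%:E = 0)%E.
Proof.
move=> hs; rewrite /lin_eval; under eq_integral do rewrite big_tnth.
have tD (i : 'I_(size s)) : D (tnth (in_tuple s) i).2.
  by apply: hs; exact: (mem_tnth i (in_tuple s)).
have [_ ->] := @integral_sumZ (size s) (fun i => (tnth (in_tuple s) i).1) (fun=> 0)
  (fun i w => X (tnth (in_tuple s) i).2 w) (fun i => iX (tD i)) (fun i => EX (tD i)).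
by rewrite big1// => i _; rewrite mulr0.
Qed.

Let var_lin s : times_in D s ->
  (\int[P]_w (lin_eval s (X ^~ w) ^+ 2)%:E = (cov s s)%:E)%E.
Proof.
move=> hs; pose tn (i : 'I_(size s)) := tnth (in_tuple s) i.
have tD i : D (tn i).2 by apply: hs; exact: (mem_tnth i (in_tuple s)).
pose F i w := \sum_(j < size s) (tn j).1 * (X (tn i).2 w * X (tn j).2 w).
transitivity (\int[P]_w (\sum_(i < size s) (tn i).1 * F i w)%:E)%E.
  apply: eq_integral => w _; congr EFin.
  rewrite /lin_eval big_tnth expr2 mulr_suml; apply: eq_bigr => i _.
  rewrite -mulrA; congr (_ * _); rewrite /F mulr_sumr; apply: eq_bigr => j _.
  by rewrite -/(tn _) -/(tn _); ring.
have inner i := integral_sumZ (fun j => (tn j).1) (fun j => iXX (tD i) (tD j))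
  (fun j => EXX (tD i) (tD j)).
have [_ ->] := @integral_sumZ _ (fun i => (tn i).1) _ F
  (fun i => (inner i).1) (fun i => (inner i).2).
rewrite [in RHS]/cov [in RHS]big_tnth; congr EFin; apply: eq_bigr => i _.
rewrite [RHS]big_tnth mulr_sumr; apply: eq_bigr => j _.
by rewrite -/(tn _) -/(tn _) mulrA.
Qed.

Let expectation_cos s th : times_in D s ->
  (\int[P]_w (1 + cos (lin_eval s (X ^~ w) + th))%:E =
   normal_cos th (Num.sqrt (cov s s / normal_var R)))%E.
Proof.
move=> hs; rewrite /normal_cos.
apply: (gaussian_expectation (gauss_lin hs) (mean_lin hs) (var_lin hs)
  (G := fun x => 1 + cos (x + th))).
- move=> x; apply: cvgD; first exact: cvg_cst.
  apply: continuous_cvg; first exact: continuous_cos.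
  by apply: cvgD; [exact: cvg_id|exact: cvg_cst].
- by move=> x; have := cos_geN1 (x + th); lra.
Qed.

Let I w := \int[mu]_(s in `[0, 1]) X s w.

(** Encodes a Riemann sum as a list of weighted times, so that the Gaussian and covariance facts
    about [lin_eval] apply to it. *)
Let grid n : seq (R * R) := [seq (n.+1%:R^-1, i%:R / n.+1%:R) | i <- iota 0 n.+1].

Let times_in_grid n : times_in D (grid n).
Proof.
move=> p /mapP[i]; rewrite mem_iota add0n => /andP[_ i_n] -> /=.
by rewrite in_itv/= divr_ge0//= ler_pdivrMr ?ltr0n// mul1r ler_nat ltnW.
Qed.

Let lin_eval_grid n w : lin_eval (grid n) w = riemann_sum w n.
Proof.
rewrite /lin_eval /grid big_map -/(index_iota 0 n.+1) big_mkord /riemann_sum mulr_sumr.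
by [].
Qed.

Let mI : measurable_fun setT I.
Proof.
apply: (measurable_fun_cvg (h := fun n w => lin_eval (grid n) (X ^~ w))).
  by move=> n; exact: measurable_lin_eval pX (@times_in_grid n).
move=> w _; under eq_fun do rewrite lin_eval_grid.
exact: cvg_riemann_sum.
Qed.

Let Y t w := X t w - g t * I w.

(** The number b = L(g) in L(Y) = L(X) - b I. *)
Let gain s := \sum_(p <- s) p.1 * g p.2.

Let lin_evalY s w : lin_eval s (Y ^~ w) = lin_eval s (X ^~ w) - gain s * I w.
Proof.
rewrite /lin_eval /gain mulr_suml -sumrB; apply: eq_bigr => p _.
by rewrite /Y mulrBr mulrA.
Qed.

(** L(X) - b I with I replaced by its Riemann sum: a finite combination of values of [X], hence
    Gaussian. *)
Let approx s n := s ++ [seq (- gain s * p.1, p.2) | p <- grid n].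

Let times_in_approx s n : times_in D s -> times_in D (approx s n).
Proof.
by move=> hs; apply: times_in_cat => //; apply: times_in_scale.
Qed.

Let cvg_approx s w : lin_eval (approx s n) (X ^~ w) @[n --> \oo] -->
  lin_eval s (Y ^~ w).
Proof.
rewrite lin_evalY; under eq_fun do rewrite lin_eval_cat lin_eval_scale.
apply: cvgD; first exact: cvg_cst.
rewrite -mulNr; apply: cvgMl_tmp.
by under eq_fun do rewrite lin_eval_grid; exact: cvg_riemann_sum.
Qed.

(** Isolating one argument turns a covariance with the grid into Riemann sums of the sections of
    [c]. *)
Let cov_lin u s : cov u s = \sum_(p <- s) p.1 * lin_eval u (c ^~ p.2).
Proof.
rewrite /cov exchange_big; apply: eq_bigr => p _ /=.
by rewrite /lin_eval mulr_sumr; apply: eq_bigr => q _; ring.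
Qed.

Let covC u s : times_in D u -> times_in D s -> cov u s = cov s u.
Proof.
move=> hu hs; rewrite /cov exchange_big; apply: eq_big_seq => p ps /=.
by apply: eq_big_seq => q qu; rewrite cC; [ring|exact: hu|exact: hs].
Qed.

Let cov_catr u s t : cov u (s ++ t) = cov u s + cov u t.
Proof. by rewrite !cov_lin big_cat. Qed.

Let cov_scaler a u s : cov u [seq (a * p.1, p.2) | p <- s] = a * cov u s.
Proof.
by rewrite !cov_lin big_map mulr_sumr; apply: eq_bigr => p _ /=; rewrite mulrA.
Qed.

Let cov_approx s n : times_in D s -> cov (approx s n) (approx s n) =
  cov s s - 2 * gain s * cov (grid n) s + gain s ^+ 2 * cov (grid n) (grid n).
Proof.
move=> hs; have hg := @times_in_grid n; have ha := @times_in_approx s n hs.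
rewrite {2}/approx cov_catr cov_scaler (covC ha hs) (covC ha hg).
rewrite /approx !cov_catr !cov_scaler (covC hs hg); ring.
Qed.

Let cvg_cov_grid s : times_in D s ->
  cov (grid n) s @[n --> \oo] --> V / 2 * gain s.
Proof.
move=> hs; under eq_fun do rewrite cov_lin; rewrite /gain mulr_sumr.
elim: s hs => [_|p s ih hs].
  by rewrite big_nil; under eq_fun do rewrite big_nil; exact: cvg_cst.
rewrite big_cons (_ : (fun n => _) = fun n => p.1 * lin_eval (grid n) (c ^~ p.2) +
    \sum_(q <- s) q.1 * lin_eval (grid n) (c ^~ q.2)); last first.
  by apply/funext => n; rewrite big_cons.
apply: cvgD; last first.
  by apply: ih => q qs; apply: hs; rewrite inE qs orbT.
have Dp : D p.2 by apply: hs; rewrite mem_head.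
rewrite mulrCA -rE//; apply: cvgMl_tmp; under eq_fun do rewrite lin_eval_grid.
exact/cvg_riemann_sum/cc.
Qed.

Let riemann_sum_dist (F G : R -> R) n e : (forall t, D t -> `|F t - G t| <= e) ->
  `|riemann_sum F n - riemann_sum G n| <= e.
Proof.
move=> FG; rewrite /riemann_sum -mulrBr -sumrB normrM ger0_norm ?invr_ge0//.
rewrite ler_pdivrMl ?ltr0n//; apply: le_trans (ler_norm_sum _ _ _) _.
have -> : n.+1%:R * e = \sum_(i < n.+1) e.
  by rewrite sumr_const card_ord mulr_natl.
apply: ler_sum => i _.
apply: FG; rewrite /= in_itv/= divr_ge0//= ler_pdivrMr ?ltr0n// mul1r ler_nat.
exact: ltnW.
Qed.

(** The inner Riemann sums approach [V / 2 * g t] uniformly in [t], since the modulus in [uc] does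
    not depend on [t]; the outer sums of this limit tend to [V] by [VE]. *)
Let cvg_cov_grid_grid : cov (grid n) (grid n) @[n --> \oo] --> V.
Proof.
have covE n : cov (grid n) (grid n) =
    riemann_sum (fun t => riemann_sum (c ^~ t) n) n.
  rewrite cov_lin -lin_eval_grid /lin_eval; apply: eq_bigr => p _.
  by rewrite -lin_eval_grid.
have rs : riemann_sum (fun t => V / 2 * g t) n @[n --> \oo] --> V.
  rewrite -[X in _ --> X]VE; apply: cvg_riemann_sum => t.
  by apply: cvgMl_tmp; exact: cg.
apply/cvgrPdist_le => e e0; have e20 : 0 < e / 2 by rewrite divr_gt0.
have [dl dl0 dlP] := uc e20.
near=> n; rewrite covE; apply: le_trans (ler_distD
  (riemann_sum (fun t => V / 2 * g t) n) _ _) _.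
rewrite [leRHS]splitr; apply: lerD.
  by near: n; have /cvgrPdist_le := rs; exact.
apply: riemann_sum_dist => t Dt; rewrite -rE//; apply: riemann_sum_le.
  by apply: continuous_compact_integrable; [exact: segment_compact|exact: cc].
move=> x y x01 y01 xy; apply: dlP => //; apply: le_lt_trans xy _.
near: n; exact: (near_infty_natSinv_lt (PosNum dl0)).
Unshelve. all: by end_near. Qed.

Let cvg_cov_approx s : times_in D s ->
  cov (approx s n) (approx s n) @[n --> \oo] --> cov s s.
Proof.
move=> hs; under eq_fun do rewrite cov_approx//.
have lim : cov s s - 2 * gain s * cov (grid n) s
      + gain s ^+ 2 * cov (grid n) (grid n) @[n --> \oo] -->
    cov s s - 2 * gain s * (V / 2 * gain s) + gain s ^+ 2 * V.
  apply: cvgD; last by apply: cvgMl_tmp; exact: cvg_cov_grid_grid.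
  by apply: cvgB; [exact: cvg_cst|apply: cvgMl_tmp; exact: cvg_cov_grid].
(* The corrections -2b (V/2) b and b^2 V cancel; this is what the factor 1/2 in [rE] is for. *)
by rewrite (_ : _ + _ = cov s s) in lim; last by field.
Qed.

Let pY : is_process D Y.
Proof.
move=> t Dt; apply: measurable_funB; first exact: pX.
by apply: measurable_funM => //; exact: mI.
Qed.

Let expectation_cosY s th : times_in D s ->
  (\int[P]_w (1 + cos (lin_eval s (Y ^~ w) + th))%:E =
   normal_cos th (Num.sqrt (cov s s / normal_var R)))%E.
Proof.
move=> hs.
have [|||mcY cY] := @bounded_cvg_integral _ _ _ P
  (fun n w => 1 + cos (lin_eval (approx s n) (X ^~ w) + th))
  (fun w => 1 + cos (lin_eval s (Y ^~ w) + th)) 2.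
- move=> n; apply: measurable_funD => //.
  exact: measurable_cos_lin pX (@times_in_approx s n hs).
- move=> n w; have := cos_geN1 (lin_eval (approx s n) (X ^~ w) + th).
  have := cos_le1 (lin_eval (approx s n) (X ^~ w) + th).
  by rewrite ler_norml => ? ?; apply/andP; split; lra.
- move=> w; apply: cvgD; first exact: cvg_cst.
  apply: continuous_cvg; first exact: continuous_cos.
  by apply: cvgD; [exact: cvg_approx|exact: cvg_cst].
(* The expectations of the approximants are values of [normal_cos] at converging deviations, so its
   continuity identifies their limit. *)
rewrite -(cvg_lim _ cY)//; apply/cvg_lim => //.
under eq_fun do rewrite (expectation_cos th (@times_in_approx s _ hs)).
apply: cvg_normal_cos; apply: continuous_cvg; first exact: sqrt_continuous.
by apply: cvgMr_tmp; exact: cvg_cov_approx.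
Qed.

Lemma eq_in_law_gaussian_reflection : eq_in_law D P X P Y.
Proof.
apply: eq_in_law_cos => // s th hs.
have shift (Z : R -> T -> R) : is_process D Z ->
    (\int[P]_w (1 + cos (lin_eval s (Z ^~ w) + th))%:E =
     1 + \int[P]_w (cos (lin_eval s (Z ^~ w) + th))%:E)%E.
  move=> pZ; under eq_integral do rewrite EFinD.
  rewrite integralD//=; last 2 first.
  - exact: finite_measure_integrable_cst.
  - apply: (@bounded_integrable _ _ _ P _ 1).
      exact: measurable_cos_lin pZ hs.
    by move=> w; exact: cos_max.
  by rewrite integral_cst//= probability_setT mule1.
have := expectation_cosY th hs; rewrite -expectation_cos// !shift//.
by move/(congr1 (fun x => x - 1)%E); rewrite !(addeC 1%E) !addeK// => ->.
Qed.

End gaussian_reflection.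

(** * The time-changed Brownian bridge *)

Section bridge.
Set Implicit Arguments.
Unset Strict Implicit.
Variables (R : realType) (d : measure_display) (T : measurableType d).
Variables (P : probability T R) (B : R -> T -> R) (k : nat).
Hypothesis hB : brownian_bridge P B.
Local Notation m := k.+1.
Local Notation H := (@beta_cdf R m).
Local Notation D := (`[0, 1]%classic : set R).
Local Notation mu := (@lebesgue_measure R).

Let X (t : R) (w : T) := B (H t) w.

Let HD t : D t -> D (H t).
Proof. by move=> Dt; apply: beta_cdf_itv. Qed.

Let cX w : {within `[0, 1], continuous (X ^~ w)}.
Proof.
have [_ _ cB _] := hB; have cH := @continuous_beta_cdf R k.
apply/subspace_continuousP => x Dx; apply/cvgrPdist_lt => e e0.
(* As [H] maps [0, 1] into itself, the moduli of the path and of [H] compose. *)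
have [d1 d10 h1] := within_unif_continuous (cB w) e0.
have [d2 d20 h2] := within_unif_continuous cH d10.
rewrite near_withinE; have := nbhsx_ballx x d2 d20.
by apply: filterS => y xy Dy; apply: h1; [exact: HD|exact: HD|exact: h2].
Qed.

(** As functions of [H x], both the minimum with [H t] and the product with [H t], which lies in
    [0, 1], are 1-Lipschitz. A modulus of [H] for [e / 2] therefore works for every [t]. *)
Let beta_cov_modulus (e : R) : 0 < e -> exists2 dl : R, 0 < dl &
  forall t x y, D t -> D x -> D y -> `|x - y| < dl ->
    `|beta_cov k x t - beta_cov k y t| <= e.
Proof.
move=> e0; have e20 : 0 < e / 2 by rewrite divr_gt0.
have [dl dl0 h] := within_unif_continuous (@continuous_beta_cdf R k) e20.
exists dl => // t x y Dt Dx Dy /(h _ _ Dx Dy)/ltW hxy.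
have /= := HD Dt; rewrite in_itv/= => /andP[Ht0 Ht1].
rewrite /beta_cov opprD addrACA -opprD -mulrBl [leRHS]splitr.
apply: le_trans (ler_normD _ _) _; apply: lerD; last first.
  rewrite normrN normrM -[leRHS]mulr1 ler_pM// ger0_norm//.
apply: le_trans hxy; move: (H x) (H y) (H t) => a b c.
have ab := ler_norm (a - b); have ba := ler_norm (b - a); rewrite distrC in ba.
rewrite ler_norml; apply/andP.
by have [?|?] := leP a c; have [?|?] := leP b c; split; lra.
Qed.

(** The constant is arranged as 2 / V times C / (2m), where V = 1 / (4 (2m+1)), so that (V / 2) g is
    the value found in [Rintegral_beta_cov]. *)
Lemma eq_in_law_bridge_beta (g : R -> R) :
  (forall t, g t =
    8 * (2 * m + 1)%:R * (beta_norm R k / (2 * m%:R)) * (t * (1 - t)) ^+ m) ->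
  eq_in_law D P X P (fun t w => X t w - g t * \int[mu]_(s in `[0, 1]) X s w).
Proof.
move=> gE; have [gB EB _ EBB] := hB.
have m1 : (2 * m + 1)%:R != 0 :> R by rewrite addn1 pnatr_eq0.
have gV t : (4 * (2 * m + 1)%:R)^-1 / 2 * g t =
    beta_norm R k / (2 * m%:R) * (t * (1 - t)) ^+ m.
  rewrite gE; move: (beta_norm R k / _) ((_ * _) ^+ m) ((2 * m + 1)%:R : R) m1.
  by move=> a b c c0; field.
apply: (@eq_in_law_gaussian_reflection R d T P X (beta_cov k) g
  (4 * (2 * m + 1)%:R)^-1).
- by move=> n t a tD; apply: gB => i; exact: HD.
- by move=> t /HD /EB; rewrite unlock.
- by move=> s t Ds Dt; have := EBB _ _ (HD Ds) (HD Dt); rewrite unlock.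
- exact: cX.
- apply: continuous_subspaceT => t.
  rewrite (_ : g = horner ((8 * (2 * m + 1)%:R * (beta_norm R k / (2 * m%:R))) *:
    ('X * (1 - 'X)) ^+ m)); first exact: continuous_horner.
  by apply/funext => u; rewrite gE !hornerE.
- by move=> t Dt; exact: continuous_beta_cov.
- exact: beta_cov_modulus.
- by move=> t Dt; rewrite Rintegral_beta_cov// gV.
- under eq_Rintegral do rewrite gV.
  exact: Rintegral_beta_cov_double.
Qed.

End bridge.

Theorem mainTheorem4 (R : realType) (d : measure_display)
    (T : measurableType d) (P : probability T R) (B : R -> T -> R)
    (m : nat) (hm : (1 <= m)%N) (hB : brownian_bridge P B) :
  eq_in_law `[0, 1]
    P (fun (t : R) (w : T) => B (beta_cdf m t) w)
    P (fun (t : R) (w : T) =>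
         B (beta_cdf m t) w
         - 4 * (2 * m + 1)%:R
           * (((2 * m - 1)`!)%:R / (m%:R * ((m - 1)`!)%:R ^+ 2))
           * (t * (1 - t)) ^+ m
           * \int[lebesgue_measure]_(s in `[0, 1]) B (beta_cdf m s) w).
Proof.
case: m hm => // k _; apply: (eq_in_law_bridge_beta hB) => t.
(* Only the constants remain to be compared: 4 / m against 8 / (2m). *)
congr (_ * _); rewrite /beta_norm.
have F0 : ((k.+1 - 1)`!)%:R != 0 :> R by rewrite pnatr_eq0 -lt0n fact_gt0.
have m0 : k.+1%:R != 0 :> R by rewrite pnatr_eq0.
move: ((k.+1 - 1)`!%:R : R) F0 (k.+1%:R : R) m0 => f f0 n n0.
by field; rewrite f0 n0.
Qed.
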